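(* Let $X$ be a Tychonoff space. For every cardinal $\aleph_\alpha\geq\aleph_1$, $C^*(X)$ is a pathwise connected subspace of $C_{\aleph_\alpha}(X)$.
   Context: Tychonoff means completely regular and Hausdorff. $C(X)$ is the set of all real-valued continuous functions on $X$ and $C^*(X)$ is the set of all bounded members of $C(X)$. For an infinite cardinal $\aleph_\alpha$, $\mathcal{A}_{\aleph_\alpha}=\{A\subseteq X: |A|<\aleph_\alpha\}$. For $f\in C(X)$, $A\in\mathcal{A}_{\aleph_\alpha}$ and real $\epsilon>0$ put $B(f,A,\epsilon)=\{g\in C(X): \sup_{x\in A}|f(x)-g(x)|<\epsilon\}$ (equal to $C(X)$ when $A=\emptyset$). The sets $B(f,A,\epsilon)$ form a base of a topology on $C(X)$; $C_{\aleph_\alpha}(X)$ denotes $C(X)$ with this topology. *)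

(* Defs.v *)
From HB Require Import structures.
From mathcomp Require Import all_boot all_order all_algebra.
From mathcomp Require Import all_classical all_reals all_analysis.
From mathcomp Require Import wochoice.
Import Order.TTheory GRing.Theory Num.Theory.
Import numFieldNormedType.Exports.

Set Implicit Arguments.
Unset Strict Implicit.
Unset Printing Implicit Defensive.

Local Open Scope classical_set_scope.
Local Open Scope card_scope.

Definition card_lt T U (A : set T) (B : set U) := (A #<= B) && ~~ (B #<= A).

(* Cardinals are represented by types, compared through [#<=]; by the axiom of
   choice the infinite cardinals are exactly the alephs. *)
Record aleph := Aleph {
  aleph_sort :> Type;
  aleph_infinite : infinite_set [set: aleph_sort]
}.

(* aleph_1 is the cardinal of omega_1, the uncountable well-order all of whose
   proper initial segments are countable. *)
Definition is_aleph1 (W : Type) := exists r : rel W, [/\ well_order r,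
  ~ countable [set: W] & forall a, countable [set w | r w a /\ w <> a]].

Definition aleph1_le (K : aleph) :=
  exists2 W : Type, is_aleph1 W & [set: W] #<= [set: K].

Lemma card_le_relP T U (A : set T) (B : set U) :
  (A #<= B) <-> exists G : T -> U -> Prop,
   (forall a, A a -> exists2 b, B b & G a b) /\
   (forall a a' b, A a -> A a' -> G a b -> G a' b -> a = a').
Proof.
split.
  move=> /card_leP[f].
  exists (fun a b => exists2 x : A, set_val x = a & set_val (f x) = b); split.
    move=> a Aa; exists (set_val (f (SigSub (mem_set Aa)))).
      exact: set_valP.
    by exists (SigSub (mem_set Aa)).
  move=> a a' b _ _ [x <- xb] [x' <- x'b]; congr set_val.
  by apply: (@inj _ _ _ f); rewrite ?inE //; apply: val_inj; exact: etrans xb (esym x'b).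
move=> [G [tot injG]]; apply/card_leP.
have h (a : A) : {b : B | G (val a) (val b)}.
  apply/cid; have [b Bb Gb] := tot _ (set_valP a).
  by exists (SigSub (mem_set Bb)).
apply/injfunPex; exists (fun a => sval (h a)) => // a a' _ _ e.
apply: val_inj; have := svalP (h a'); have := svalP (h a); rewrite /= e => + +.
by apply: injG; apply: set_valP.
Qed.

Lemma total_bigcup2 T (F : set (set T)) x y : total_on F subset ->
  (\bigcup_(X in F) X) x -> (\bigcup_(X in F) X) y ->
  exists2 X, F X & X x /\ X y.
Proof.
move=> tF [X FX Xx] [Y FY Yy].
by have [XY|YX] := tF _ _ FX FY; [exists Y|exists X] => //; split => //;
  [exact: XY|exact: YX].
Qed.

Lemma card_le_total T U (A : set T) (B : set U) : (A #<= B) \/ (B #<= A).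
Proof.
pose P (G : set (T * U)) := [/\ G `<=` A `*` B,
  forall p q, G p -> G q -> p.1 = q.1 -> p.2 = q.2 &
  forall p q, G p -> G q -> p.2 = q.2 -> p.1 = q.1].
have [|G [[GAB G1 G2] Gmax]] := @Zorn_bigcup _ P.
  move=> F FP tF; split.
  - by move=> p [X /FP[+ _ _]]; apply.
  - by move=> p q pF qF; have [X /FP[_ + _] []] := total_bigcup2 tF pF qF; apply.
  - by move=> p q pF qF; have [X /FP[_ _ +] []] := total_bigcup2 tF pF qF; apply.
have [[a Aa nG]|domG] := pselect (exists2 a, A a & forall b, ~ G (a, b)).
  right; apply/card_le_relP; exists (fun b a => G (a, b)); split.
    move=> b Bb; apply: contrapT => nGb.
    have ngb a' : ~ G (a', b).
      by move=> ga; apply: nGb; exists a' => //; have [] := GAB _ ga.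
    apply: (Gmax (G `|` [set (a, b)])).
      split; first by move=> ?; left.
      by move=> /(_ (a, b)) h; apply: (nG b); apply: h; right.
    split.
    - by move=> p [/GAB //|->].
    - by move=> [p1 p2] [q1 q2] [gp|[-> ->]] [gq|[-> ->]] //= e;
        [exact: (G1 _ _ gp gq)|subst; case: (nG _ gp)|subst; case: (nG _ gq)].
    - by move=> [p1 p2] [q1 q2] [gp|[-> ->]] [gq|[-> ->]] //= e;
        [exact: (G2 _ _ gp gq)|subst; case: (ngb _ gp)|subst; case: (ngb _ gq)].
  by move=> b b' a' _ _ g g'; exact: (G1 _ _ g g').
left; apply/card_le_relP; exists (fun a b => G (a, b)); split.
  move=> a Aa; apply: contrapT => nGa; apply: domG; exists a => // b g.
  by apply: nGa; exists b => //; have [] := GAB _ g.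
by move=> b b' a' _ _ g g'; exact: (G2 _ _ g g').
Qed.

Lemma card_setU_le T U (A B : set T) (D : set U) : A #<= D -> B #<= D ->
  A `|` B #<= D `*` [set: bool].
Proof.
move=> /card_le_relP[G [Gt Gi]] /card_le_relP[H [Ht Hi]]; apply/card_le_relP.
exists (fun a p => if p.2 then A a /\ G a p.1 else B a /\ H a p.1); split.
  move=> a [Aa|Ba].
    by have [d Dd g] := Gt _ Aa; exists (d, true).
  by have [d Dd g] := Ht _ Ba; exists (d, false).
move=> a a' [d []] _ _ /= [? ?] [? ?]; [exact: (Gi _ _ d)|exact: (Hi _ _ d)].
Qed.

Lemma card_double T (A : set T) : infinite_set A -> A `*` [set: bool] #<= A.
Proof.
move=> Ainf.
pose dom (G : set (T * bool * T)) := [set a | exists b c, G ((a, b), c)].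
pose P (G : set (T * bool * T)) := [/\ forall p, G p -> A p.1.1,
  forall p q, G p -> G q -> p.1 = q.1 -> p.2 = q.2,
  forall p q, G p -> G q -> p.2 = q.2 -> p.1 = q.1 &
  (forall p, G p -> (forall b, exists c, G ((p.1.1, b), c)) /\ dom G p.2)].
have [|G [[GA G1 G2 Gd] Gmax]] := @Zorn_bigcup _ P.
  move=> F FP tF; split.
  - by move=> p [X /FP[+ _ _ _]]; apply.
  - by move=> p q pF qF; have [X /FP[_ + _ _] []] := total_bigcup2 tF pF qF; apply.
  - by move=> p q pF qF; have [X /FP[_ _ + _] []] := total_bigcup2 tF pF qF; apply.
  - move=> p [X FX Xp]; have [_ _ _ /(_ _ Xp)[h [b [c Xc]]]] := FP _ FX; split.
      by move=> b'; have [c' ?] := h b'; exists c', X.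
    by exists b, c, X.
set D := dom G.
have DA : D `<=` A by move=> a [b [c /GA]].
have DD : D `*` [set: bool] #<= D.
  apply/card_le_relP; exists (fun p c => G (p, c)); split.
    move=> [a b] [/= [b' [c' Gc]] _]; have [/(_ b)[c g] _] := Gd _ Gc.
    by exists c => //; have [] := Gd _ g.
  by move=> p q c _ _ gp gq; exact: (G2 _ _ gp gq).
have fAD : finite_set (A `\` D).
  apply: contrapT => /infiniteP/card_le_relP[H [Ht Hi]].
  have /choice[f fP] : forall n, exists c, (A `\` D) c /\ H n c.
    by move=> n; have [c ? ?] := Ht n Logic.I; exists c.
  have finj : injective f.
    move=> m n e; apply: (Hi m n (f m)) => //; first by have [] := fP m.
    by rewrite e; have [] := fP n.
  have fD n : ~ D (f n) by have [[]] := fP n.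
  pose E := [set p : T * bool * T |
    exists n (b : bool), p = ((f n, b), f (b + n.*2)%N)].
  have E2D p : G p -> D p.2 by move=> /Gd[].
  have E1D p : G p -> D p.1.1.
    by case: p => -[a b] c g; exists b, c.
  apply: (Gmax (G `|` E)).
    split; first by move=> ?; left.
    move=> /(_ ((f 0, false), f 0)) h; apply: (fD 0); exists false, (f 0).
    by apply: h; right; exists 0, false.
  split.
  - move=> p [/GA //|[n [b ->]]] /=; by have [[]] := fP n.
  - move=> p q [gp|[n [b ->]]] [gq|[m [c ->]]] /=.
    + exact: G1.
    + by move=> e; have := E1D _ gp; rewrite e /= => /fD.
    + by move=> e; have := E1D _ gq; rewrite -e /= => /fD.
    + by case=> /finj -> ->.
  - move=> p q [gp|[n [b ->]]] [gq|[m [c ->]]] /=.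
    + exact: G2.
    + by move=> e; have := E2D _ gp; rewrite e /= => /fD.
    + by move=> e; have := E2D _ gq; rewrite -e /= => /fD.
    + move=> /finj e; have /(congr1 odd) := e; rewrite !oddD !odd_double !addbF.
      have /(congr1 half) := e; rewrite !half_bit_double => ->.
      by case: b {e} => //; case: c.
  - move=> p [gp|[n [b ->]]] /=.
      have [h [b [c d]]] := Gd _ gp; split.
        by move=> b'; have [c' ?] := h b'; exists c'; left.
      by exists b, c; left.
    split.
      by move=> b'; exists (f (b' + n.*2)%N); right; exists n, b'.
    exists false, (f (false + (b + n.*2).*2)%N); right.
    by exists (b + n.*2)%N, false.
have Dinf : infinite_set D.
  move=> fD; apply: Ainf.
  by rewrite -(setDKU DA) finite_setU.
have AD : A #<= D.
  rewrite -(setDKU DA); apply: card_le_trans DD; apply: card_setU_le => //.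
  have /infiniteP := Dinf; apply: card_le_trans.
  exact/finite_set_countable.
apply: card_le_trans (subset_card_le DA); apply: card_le_trans DD.
have /card_le_relP[H [Ht Hi]] := AD.
apply/card_le_relP; exists (fun p q => p.2 = q.2 /\ H p.1 q.1); split.
  by move=> [a b] [/= /Ht[d ? ?] _]; exists (d, b).
move=> [a b] [a' b'] [d c] /= [? _] [? _] [-> ?] [-> ?]; congr pair.
exact: (Hi _ _ d).
Qed.

Lemma card_lt_setU T U (A B : set T) (K : set U) : infinite_set K ->
  card_lt A K -> card_lt B K -> card_lt (A `|` B) K.
Proof.
suff wlog_le (C D : set T) : infinite_set K -> C #<= D ->
    card_lt D K -> card_lt (C `|` D) K.
  move=> Kinf; have [AB _ BK|BA AK _] := card_le_total A B.
    exact: wlog_le.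
  by rewrite setUC; exact: wlog_le.
move=> Kinf CD /andP[DK nKD].
have [fD|iD] := pselect (finite_set D).
  have fCD : finite_set (C `|` D).
    by rewrite finite_setU; split => //; exact: card_le_finite CD fD.
  apply/andP; split.
    have /infiniteP := Kinf; apply: card_le_trans.
    exact/finite_set_countable.
  by apply/negP => KCD; apply: Kinf; exact: card_le_finite KCD fCD.
have UD : C `|` D #<= D.
  exact: card_le_trans (card_setU_le CD (card_lexx D)) (card_double iD).
apply/andP; split; first exact: card_le_trans UD DK.
by apply: contra nKD => KCD; exact: card_le_trans KCD UD.
Qed.

Lemma aleph1_leP (K : aleph) : aleph1_le K <-> ~ countable [set: K].
Proof.
split=> [[W [r [_ nW _]] WK] cK|nK].
  by apply: nW; exact: card_le_trans WK cK.
have [r rwo] := well_ordering_principle {classic K}.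
pose seg (a : K) : set K := [set w | r w a /\ w <> a].
have [allc|/existsNP[a0 na0]] := pselect (forall a, countable (seg a)).
  by exists K => //; exists r.
have [|a [[/asboolP na amin] _]] :=
    rwo (fun a => `[< ~ countable (seg a) >]).
  by exists a0; apply/asboolP.
pose W := {w : K | seg a w}.
have injW : injective (sval : W -> K) by move=> x y; exact: eq_sig_hprop.
have rmin (A : pred K) x : A x -> exists z,
    [/\ A z, (forall y, A y -> r z y) &
        forall t, A t -> (forall y, A y -> r t y) -> t = z].
  move=> Ax; have [|z [[Az zmin] zu]] := rwo A; first by exists x.
  by exists z; split=> // t At tmin; rewrite -(zu t).
have rr : reflexive (r : rel {classic K}).
  move=> x; have [z [/eqP zx zmin _]] := @rmin (pred1 (x : {classic K})) x (eqxx _).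
  by rewrite -{1}zx; apply: zmin => /=.
have rtot : total (r : rel {classic K}).
  move=> x y.
  have [|z [/orP zxy zmin _]] := @rmin (pred2 (x : {classic K}) y) x.
    by rewrite /= eqxx.
  have zx : r z x by apply: zmin; rewrite /= eqxx.
  have zy : r z y by apply: zmin; rewrite /= eqxx orbT.
  by case: zxy => /eqP <-; rewrite ?zx ?zy ?orbT.
have ranti : antisymmetric (r : rel {classic K}).
  move=> x y /andP[xy yx].
  have [|z [_ _ zu]] := @rmin (pred2 (x : {classic K}) y) x.
    by rewrite /= eqxx.
  have zx : x = z.
    apply: zu => /=; first by rewrite eqxx.
    by move=> t /orP[/eqP ->|/eqP ->]; [exact: rr|exact: xy].
  have zy : y = z.
    apply: zu => /=; first by rewrite eqxx orbT.
    by move=> t /orP[/eqP ->|/eqP ->]; [exact: yx|exact: rr].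
  by rewrite zx zy.
have rtrans : transitive (r : rel {classic K}).
  move=> y x z xy yz.
  have [|t [/or3P txyz tmin _]] := @rmin (pred3 (x : {classic K}) y z) x.
    by rewrite /= eqxx.
  have tx : r t x by apply: tmin; rewrite /= eqxx.
  have ty : r t y by apply: tmin; rewrite /= eqxx orbT.
  have tz : r t z by apply: tmin; rewrite /= eqxx !orbT.
  case: txyz => /eqP te; rewrite -?te // in xy yz *.
    by have -> : x = t by apply: ranti; rewrite xy tx.
  by have <- : y = t by apply: ranti; rewrite yz ty.
exists W; last first.
  apply/card_le_relP; exists (fun w k => sval w = k); split.
    by move=> w _; exists (sval w).
  by move=> w w' k _ _ <- /injW.
exists (fun x y => r (sval x) (sval y)); split.
- move=> A [x Ax].
  have [|m [[/asboolP[mW Am] mmin] mu]] := rwo (fun k =>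
      `[< exists h : seg a k, exist (seg a) k h \in A >]).
    case: x Ax => x hx Ax; exists x; apply/asboolP; by exists hx.
  exists (exist _ m mW); split; first split => //.
    move=> [y hy] Ay /=; apply: mmin; apply/asboolP; by exists hy.
  move=> [y hy] [Ay ymin]; apply: injW => /=; apply: mu; split.
    by apply/asboolP; exists hy.
  by move=> z /asboolP[hz Az]; exact: (ymin (exist _ z hz)).
- move=> cW; apply: na; apply: card_le_trans cW; apply/card_le_relP.
  exists (fun k w => k = sval w); split.
    by move=> k hk; exists (exist _ k hk).
  by move=> k k' w _ _ -> ->.
- move=> [b [rba ba]] /=.
  have cb : countable (seg b).
    apply: contrapT => nb; apply: ba; apply: ranti; rewrite rba /=.
    by apply: amin; apply/asboolP.
  apply: card_le_trans cb; apply/card_le_relP.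
  exists (fun w k => sval w = k); split.
    move=> w [rwb wb]; exists (sval w) => //; split => // e.
    by apply: wb; apply: injW.
  by move=> w w' k _ _ <- /injW.
Qed.

Local Open Scope ring_scope.

(* C(X), to carry the topology depending on K; [continuousType X R] itself
   already has the compact-open topology in the library. *)
Definition C_aleph (X : topologicalType) (R : realType) (K : aleph) : Type :=
  continuousType X R.

Section C_aleph.
Context {X : topologicalType} {R : realType} {K : aleph}.

Definition C_aleph_fun (f : C_aleph X R K) : X -> R :=
  (f : continuousType X R).
Coercion C_aleph_fun : C_aleph >-> Funclass.

HB.instance Definition _ := Choice.copy (C_aleph X R K) (continuousType X R).
HB.instance Definition _ := isPointed.Build (C_aleph X R K)
  (cst 0 : continuousType X R).

Definition small_sets : set (set X) := [set A | card_lt A [set: K]].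

(* The supremum is taken in [\bar R], so that it is [+oo] for an unbounded
   difference and [-oo] for A empty. *)
Definition Cball (f : C_aleph X R K) (A : set X) (e : R) :
    set (C_aleph X R K) :=
  [set g | (ereal_sup [set `|f x - g x|%:E | x in A] < e%:E)%E].

Definition Cball_index : set (C_aleph X R K * set X * R) :=
  [set p | small_sets p.1.2 /\ 0 < p.2].

Definition Cball_of (p : C_aleph X R K * set X * R) := Cball p.1.1 p.1.2 p.2.

Lemma small_sets0 : small_sets set0.
Proof.
apply/andP; split=> //; rewrite card_le0; apply/eqP => K0.
by apply: (@aleph_infinite K); rewrite K0.
Qed.

Lemma CballP f A e g : 0 < e -> Cball f A e g <->
  exists2 d, 0 <= d < e & forall x, A x -> `|f x - g x| <= d.
Proof.
move=> e0; split=> [|[d /andP[d0 de] fg]]; last first.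
  apply: (@le_lt_trans _ _ d%:E); last by rewrite lte_fin.
  by apply: ge_ereal_sup => _ [x Ax <-]; rewrite lee_fin fg.
rewrite /Cball /=; set s := ereal_sup _ => se.
have sub x : A x -> (`|f x - g x|%:E <= s)%E.
  by move=> Ax; apply: ereal_sup_ubound; exists x.
case: s se sub => [s se sub|+ _|_ sub]; last 1 first.
- exists 0; first by rewrite lexx.
  by move=> x /sub; rewrite leeNy_eq.
- exists (Num.max 0 s).
    by rewrite le_max lexx /= gt_max e0 -lte_fin.
  by move=> x /sub; rewrite lee_fin le_max orbC => ->.
- by rewrite ltNge leey.
Qed.

Lemma Cball_cover : \bigcup_(p in Cball_index) Cball_of p = setT.
Proof.
apply/seteqP; split=> // f _; exists (f, set0, 1).
  by split=> //=; exact: small_sets0.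
by apply/CballP => //; exists 0; rewrite ?lexx ?ltr01.
Qed.

Lemma Cball_join p q h : Cball_index p -> Cball_index q ->
  Cball_of p h -> Cball_of q h ->
  exists k, [/\ Cball_index k, Cball_of k h &
               Cball_of k `<=` Cball_of p `&` Cball_of q].
Proof.
move: p q => [[f A] e] [[g B] e'] [/= sA e0] [/= sB e0'].
move=> /(CballP _ _ _ e0)[d /andP[d0 de] fh].
move=> /(CballP _ _ _ e0')[d' /andP[d0' de'] gh].
pose r := Num.min (e - d) (e' - d').
have r0 : 0 < r by rewrite lt_min !subr_gt0 de.
exists (h, A `|` B, r); split.
- by split=> //; apply: card_lt_setU => //; exact: aleph_infinite.
- apply/CballP => //; exists 0; first by rewrite lexx.
  by move=> x _; rewrite subrr normr0.
- move=> k /(CballP _ _ _ r0)[s /andP[s0 +] hk].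
  rewrite lt_min !ltrBrDl => /andP[sd sd'].
  split; apply/CballP => //=.
    exists (d + s); first by rewrite addr_ge0.
    move=> x Ax; rewrite -(subrKA (h x)) (le_trans (ler_normD _ _))//.
    by rewrite lerD ?fh ?hk//; left.
  exists (d' + s); first by rewrite addr_ge0.
  move=> x Bx; rewrite -(subrKA (h x)) (le_trans (ler_normD _ _))//.
  by rewrite lerD ?gh ?hk//; right.
Qed.

HB.instance Definition _ := isBaseTopological.Build (C_aleph X R K)
  Cball_cover Cball_join.

Definition C_star : set (C_aleph X R K) := [set f | bounded_fun f].

End C_aleph.

Arguments C_star : clear implicits.

Definition pathwise_connected (R : realType) (T : topologicalType) :=
  forall x y : T, exists p : R -> T,
    [/\ {within `[0, 1], continuous p}, p 0 = x & p 1 = y].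

(* Main.v *)
(** Two bounded functions [f] and [g] are joined by the segment
    [t |-> f + t (g - f)].  If [g - f] is bounded by [M], two points of the
    segment with parameters [s] and [t] are at uniform distance at most
    [M |s - t|], so the segment is continuous for the topology of uniform
    convergence, hence for the coarser topology of [C_aleph]. *)
Require Import Defs.
From mathcomp Require Import all_boot all_order all_algebra.
From mathcomp Require Import all_classical all_reals all_analysis.
From mathcomp Require Import ring.
Import Order.TTheory GRing.Theory Num.Theory.
Import numFieldNormedType.Exports.

Local Open Scope classical_set_scope.
Local Open Scope ring_scope.

Section segment.
Context {X : topologicalType} {R : realType} {K : aleph}.
Implicit Types f g h : C_aleph X R K.

(** A basic set containing [h] may be centred at another [f]. As [h] stays within some [d < e] of
    [f] on [A], the triangle inequality recentres it at [h] with radius [e - d]. *)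
Lemma nbhs_Cball h (U : set (C_aleph X R K)) : nbhs h U ->
  exists (A : set X) (e : R), 0 < e /\ Cball h A e `<=` U.
Proof.
rewrite nbhsE => -[_ [[D DI <-] [[[f A] e] Dp]]].
have [_ /= e0] := DI _ Dp.
move=> /(CballP _ _ _ e0)[d /andP[d0 de] fh] DU.
have r0 : 0 < e - d by rewrite subr_gt0.
exists A, (e - d); split=> // k /(CballP _ _ _ r0)[s /andP[s0 +] hk].
rewrite ltrBrDl => sde; apply: DU; exists (f, A, e) => //.
apply/CballP => //; exists (d + s); first by rewrite addr_ge0.
move=> x Ax; rewrite -(subrKA (h x)) (le_trans (ler_normD _ _))//.
by rewrite lerD ?fh ?hk.
Qed.

Lemma cts_segment f g (t : R) : continuous (fun x => f x + t * (g x - f x)).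
Proof.
move=> x; have cf := @cts_fun _ _ (f : continuousType X R) x.
have cg := @cts_fun _ _ (g : continuousType X R) x.
by apply: cvgD => //; apply: cvgM; [exact: cvg_cst|exact: cvgB].
Qed.

Definition segment f g (t : R) : C_aleph X R K :=
  (mkcts (cts_segment f g t) : continuousType X R).

Lemma segmentE f g t x : segment f g t x = f x + t * (g x - f x).
Proof. by []. Qed.

Lemma C_aleph_eq f g : (forall x, f x = g x) -> f = g.
Proof. by move=> fg; apply/continuousEP. Qed.

Lemma segment0 f g : segment f g 0 = f.
Proof. by apply: C_aleph_eq => x; rewrite segmentE mul0r addr0. Qed.

Lemma segment1 f g : segment f g 1 = g.
Proof. by apply: C_aleph_eq => x; rewrite segmentE mul1r addrC subrK. Qed.

(** Trades the filter form of boundedness, near [+oo], for one explicit bound. *)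
Lemma C_starP f : C_star X R K f <-> exists M : R, forall x, `|f x| <= M.
Proof.
split=> [/pinfty_ex_gt0[M _ fM]|[M fM]]; first by exists M => x; exact: fM.
rewrite /C_star /= /bounded_near; near=> N => x _ /=.
by rewrite (le_trans (fM x)).
Unshelve. all: by end_near. Qed.

Lemma C_star_segment f g t : C_star X R K f -> C_star X R K g ->
  C_star X R K (segment f g t).
Proof.
move=> /C_starP[M fM] /C_starP[N gN]; apply/C_starP.
exists (M + `|t| * (N + M)) => x; rewrite segmentE.
rewrite (le_trans (ler_normD _ _))// lerD// normrM ler_wpM2l//.
by rewrite (le_trans (ler_normB _ _))// lerD.
Qed.

Lemma segment_continuous f g : C_star X R K f -> C_star X R K g ->
  continuous (segment f g).
Proof.
move=> /C_starP[M fM] /C_starP[N gN] s U /nbhs_Cball[A [e [e0 /filterS]]].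
(* [B] bounds [g - f]. The absolute value and [+ 1] make it positive even if [X] is empty and
   [N + M] negative, so that it can be a divisor. *)
apply; set B := `|N + M| + 1.
have B0 : 0 < B by rewrite ltr_wpDl.
have [d d0 dB] : exists2 d, 0 < d & d * B < e.
  (* Here [d * B = e / 2], which keeps the supremum strictly below [e]. *)
  by exists (e / 2 / B); rewrite ?divr_gt0// divfK ?gt_eqF// gtr_pMr ?invf_lt1// ltr1n.
apply/nbhs_ballP; exists d => //= t; rewrite /ball/= => /ltW std.
apply/CballP => //; exists (d * B); first by rewrite dB mulr_ge0// ltW.
move=> x _; rewrite !segmentE.
have -> : f x + s * (g x - f x) - (f x + t * (g x - f x)) =
  (s - t) * (g x - f x) by ring.
rewrite normrM ler_pM// (le_trans (ler_normB _ _))//.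
by rewrite (le_trans (lerD (gN x) (fM x)))// (le_trans (ler_norm _))// lerDl.
Qed.

End segment.

Theorem corollary3p6 (R : realType) (X : topologicalType)
  (crX : completely_regular_space X) (hX : hausdorff_space X)
  (K : aleph) (hK : aleph1_le K) :
  pathwise_connected R (C_star X R K).
Proof.
move=> [f bf] [g bg].
(* The whole line through [f] and [g] is bounded, so the path is defined for every real [t]. *)
have sC t := mem_set (C_star_segment _ _ t (set_mem bf) (set_mem bg)).
exists (fun t => SigSub (sC t)); split.
(* The subspace topology is initial for the inclusion, so continuity is checked in [C_aleph]. *)
- apply: continuous_subspaceT; apply: continuous_comp_initial.
  exact: (segment_continuous _ _ (set_mem bf) (set_mem bg)).
- by apply: val_inj; exact: segment0.
- by apply: val_inj; exact: segment1.
Qed.
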